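(* For any $1 \le r < \infty$ there is a non-vanishing Hölder continuous vector field $X$ on $\mathbb{R}^2$ with the property that there is a family of pairwise distinct $C^1$ foliations $\mathcal{F}_t$ of $\mathbb{R}^2$, for $t \in [0,1]$, such that $X$ is tangent to each foliation $\mathcal{F}_t$. Moreover, each leaf of each foliation $\mathcal{F}_t$ is the graph of a $C^r$ function from $\mathbb{R}$ to $\mathbb{R}$.
   Context: Foliations are one-dimensional foliations of the plane $\mathbb{R}^2$. A non-vanishing vector field $X$ is tangent to a foliation $\mathcal{F}$ if, at every point $p\in\mathbb{R}^2$, the vector $X(p)$ is tangent to the leaf of $\mathcal{F}$ through $p$. The graph of $f:\mathbb{R}\to\mathbb{R}$ is the set $\{(x,f(x)) : x\in\mathbb{R}\}$. *)

(* Defs.v *)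
From mathcomp Require Import all_boot all_order all_algebra.
From mathcomp Require Import all_classical all_reals all_analysis.

Set Implicit Arguments.
Unset Strict Implicit.
Unset Printing Implicit Defensive.

Import Order.TTheory GRing.Theory Num.Theory.
Import numFieldNormedType.Exports.

Local Open Scope ring_scope.
Local Open Scope classical_set_scope.

(* The plane is [R * R]; its library norm is the sup norm, which is equivalent
   to the Euclidean one. *)

Definition holder_on (R : realType) (V W : normedModType R)
    (a : R) (A : set V) (f : V -> W) : Prop :=
  exists C : R, forall x y : V, A x -> A y ->
    `|f x - f y| <= C * (`|x - y| `^ a).

Definition holder_continuous (R : realType) (V W : normedModType R)
    (f : V -> W) : Prop :=
  exists a : R, [/\ 0 < a, a <= 1 & holder_on a setT f].

Definition class_Ck (R : realType) (k : nat) (f : R -> R) : Prop :=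
  (forall j : nat, (j < k)%N -> forall x : R, derivable (f^`(j)) x 1) /\
  continuous (f^`(k)).

(* For an integer [r] this is exactly [class_Ck r]; for a non-integer [r] the
   derivative of order floor(r) is moreover locally Hoelder with exponent the
   fractional part of [r]. *)
Definition class_Cr (R : realType) (r : R) (f : R -> R) : Prop :=
  let k := Num.truncn r in
  let a := r - k%:R in
  class_Ck k f /\
  (0 < a -> forall M : R, holder_on a [set` `[- M, M]] (f^`(k))).

Definition graph (R : realType) (f : R -> R) : set (R * R) :=
  [set p | p.2 = f p.1].

Definition path_connected (R : realType) (L : set (R * R)) : Prop :=
  forall p q : R * R, L p -> L q ->
    exists gamma : R -> R * R,
      [/\ {within `[0, 1], continuous gamma}, gamma 0 = p, gamma 1 = q
        & gamma @` `[0, 1] `<=` L].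

Definition unit_square (R : realType) : set (R * R) := `]-1, 1[ `*` `]-1, 1[.

Definition homeo_between (R : realType) (U V : set (R * R))
    (phi psi : R * R -> R * R) : Prop :=
  [/\ phi @` U `<=` V, psi @` V `<=` U,
      (forall p, U p -> psi (phi p) = p), (forall q, V q -> phi (psi q) = q)
    & {within U, continuous phi} /\ {within V, continuous psi}].

Definition plaque (R : realType) (psi : R * R -> R * R) (c : R) : set (R * R) :=
  [set psi (s, c) | s in `]-1, 1[].

(* [psi] is the inverse of the chart [phi]. *)
Definition foliated_chart (R : realType) (F : set (set (R * R)))
    (U : set (R * R)) (phi psi : R * R -> R * R) : Prop :=
  [/\ open U, homeo_between U (@unit_square R) phi psi
    & forall L, F L -> forall p, (L `&` U) p ->
        connected_component (L `&` U) p = plaque psi (phi p).2].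

(* The plaques of the chart are regular C^1 arcs, with velocity depending
   continuously on the point of the chart. *)
Definition leafwise_C1 (R : realType) (psi : R * R -> R * R) : Prop :=
  let velocity (q : R * R) : R * R := (fun s : R => psi (s, q.2))^`() q.1 in
  [/\ forall q, unit_square q -> derivable (fun s : R => psi (s, q.2)) q.1 1,
      forall q, unit_square q -> velocity q != 0
    & {within @unit_square R, continuous velocity}].

(* A C^1 foliation of the plane, given by its set of leaves. The leaves are C^1
   curves whose tangent lines vary continuously; the charts are only required to
   be homeomorphisms transversely to the leaves. If the charts were C^1
   diffeomorphisms, a nowhere zero continuous vector field tangent to the
   foliation would have no integral curve outside the leaves, hence it would be
   tangent to a single foliation. *)
Definition C1_foliation (R : realType) (F : set (set (R * R))) : Prop :=
  [/\ partition F id setT,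
      forall L, F L -> path_connected L
    & forall p : R * R, exists U phi psi,
        [/\ U p, foliated_chart F U phi psi & leafwise_C1 psi]].

Definition tangent_vector (R : realType) (L : set (R * R)) (p v : R * R) : Prop :=
  exists gamma : R -> R * R,
    [/\ gamma 0 = p,
        \forall s \near (0 : R),
          [/\ L (gamma s), derivable gamma s 1 & {for s, continuous gamma^`()}]
      & gamma^`() 0 = v].

Definition tangent_to_foliation (R : realType) (X : R * R -> R * R)
    (F : set (set (R * R))) : Prop :=
  forall L p, F L -> L p -> tangent_vector L p (X p).

(* Main.v *)
Require Import Defs.
From mathcomp Require Import all_boot all_order all_algebra.
From mathcomp Require Import all_classical all_reals all_analysis.
From mathcomp Require Import measurable_realfun zify ring lra.

Import Order.TTheory GRing.Theory Num.Theory.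
Import numFieldNormedType.Exports.

Local Open Scope ring_scope.
Local Open Scope classical_set_scope.

(* Take X(x, y) = (1, w(S^-1 y)), where S is a primitive of a weight w >= 0
   which is flat on a fat Cantor set K and positive off K. Then S solves
   y' = w(S^-1 y), and so does every function obtained from S by waiting at the
   points of K: if m is the devil's staircase of K and tau_t is the inverse of
   u |-> u + t m(u), then tau_t moves at speed 1 off K and is 1-Lipschitz, so
   S o tau_t solves the same equation, and it is as smooth as S because all
   derivatives of S vanish on K. The horizontal translates of its graph are the
   leaves of F_t. Since w is nonnegative and Lipschitz, w o S^-1 is
   1/2-Hoelder. *)

(** * Functions of a real variable *)

(** The waiting must be spread so thinly that no leaf rests at any height: a graph that is constant
    on an interval meets its own small horizontal translates. Since [m] is continuous, no single
    point of [K] receives any waiting time, although crossing from -1 to 1 takes [t * m 1] longer.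
    So [S o tau_t] is still an increasing bijection, and its translates fill the plane without
    crossing.

    As [r] is finite, a weight of finite flatness is enough: a power of the product of the distances
    to the two ends of a gap. Its derivatives are again combinations of such monomials, so
    smoothness reduces to counting exponents. *)

Lemma near_between (R : realFieldType) (a b x : R) : a < x < b ->
  \forall z \near x, a < z < b.
Proof.
move=> /andP[ax xb].
by near do (apply/andP; split); [exact: lt_nbhsr|exact: lt_nbhsl].
Unshelve. all: by end_near. Qed.

Lemma is_derive_continuous (R : realType) (f df : R -> R) :
  (forall x : R, is_derive x 1 f (df x)) -> continuous f.
Proof.
move=> hf x; apply: differentiable_continuous.
by apply/derivable1_diffP; apply: ex_derive; exact: hf.
Qed.

Lemma derivative_bound (R : realType) (f df : R -> R) (a b C : R) :
  (forall x : R, is_derive x 1 f (df x)) ->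
  (forall x, `|df x| <= C) -> `|f a - f b| <= C * `|a - b|.
Proof.
move=> hf hC.
wlog ab : a b / b <= a.
  move=> H; case: (leP b a) => [/H //|/ltW /H].
  by rewrite distrC [X in _ <= _ * X]distrC.
have [c _ ->] := MVT_segment ab (fun x _ => hf x)
  (continuous_subspaceT (is_derive_continuous R f df hf)).
by rewrite normrM ler_wpM2r.
Qed.

Lemma increasing_surjective_continuous (R : realType) (f : R -> R) :
  {homo f : x y / x < y} -> (forall y, exists x, f x = y) -> continuous f.
Proof.
move=> finc fsurj x; apply/cvgrPdist_le => e e0.
have [a fa] := fsurj (f x - e); have [b fb] := fsurj (f x + e).
have fle : {mono f : x y / x <= y} by exact: le_mono.
have flt : {mono f : x y / x < y} by exact: leW_mono.
have ax : a < x by rewrite -flt fa; lra.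
have xb : x < b by rewrite -flt fb; lra.
have : \forall z \near x, a < z < b by apply: near_between; rewrite ax.
apply: filterS => z /andP[az zb].
by have := finc _ _ az; have := finc _ _ zb; rewrite ler_norml fa fb; lra.
Qed.

Lemma is_derive_pair (R : realType) (f g : R -> R) (x df dg : R) :
  is_derive x 1 f df -> is_derive x 1 g dg ->
  is_derive x 1 (fun s => (f s, g s) : R * R) (df, dg).
Proof.
move=> [fd fe] [gd ge].
have Hf : h^-1 *: ((f \o shift x) (h *: 1) - f x) @[h --> 0^'] --> df by rewrite -fe; exact: fd.
have Hg : h^-1 *: ((g \o shift x) (h *: 1) - g x) @[h --> 0^'] --> dg by rewrite -ge; exact: gd.
have H := cvg_pair Hf Hg.
split; first by apply/cvg_ex; exists (df, dg); exact: H.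
by apply: cvg_lim; [exact: norm_hausdorff|exact: H].
Qed.

Lemma segment_primitive (R : realType) (f : R -> R) (M : R) : continuous f ->
  0 < M -> exists F : R -> R, F 0 = 0 /\ forall x : R, `|x| < M -> is_derive x 1 F (f x).
Proof.
move=> fc M0.
pose G (x : R) := (\int[lebesgue_measure]_(t in `[- M, x]) f t)%R.
exists (fun x => G x - G 0); split; first by rewrite subrr.
move=> x; rewrite ltr_norml => /andP[Mx xM].
have [dG GE] : derivable G x 1 /\ G^`() x = f x.
  apply: (continuous_FTC1_closed xM) => //; last exact: fc.
  apply: continuous_compact_integrable; first exact: segment_compact.
  exact: continuous_subspaceT.
have : is_derive x 1 (G - cst (G 0)) (f x - 0).
  apply: is_deriveB; apply: DeriveDef; first exact: dG.
  by rewrite -derive1E.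
by rewrite subr0.
Qed.

(** Primitives on growing segments, all normalized to vanish at 0, agree wherever two of them are
    defined, so they glue. The index [Num.truncn] of the absolute value may jump near [x], which
    this agreement absorbs. *)
Lemma continuous_primitive (R : realType) (f : R -> R) : continuous f ->
  exists F : R -> R, forall x : R, is_derive x 1 F (f x).
Proof.
move=> fc.
have /choice[G HG] : forall n : nat, exists F : R -> R,
    F 0 = 0 /\ forall x : R, `|x| < n.+1%:R -> is_derive x 1 F (f x).
  by move=> n; exact: segment_primitive.
have Geq (m n : nat) (x : R) : `|x| < m.+1%:R -> `|x| < n.+1%:R -> G m x = G n x.
  move=> xm xn.
  have key (a b : R) : a <= b -> `|a| <= `|x| -> `|b| <= `|x| -> (G m - G n) b = (G m - G n) a.
    move=> ab ax bx.
    have D y : y \in `[a, b]%R -> is_derive y 1 (G m - G n) 0.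
      rewrite in_itv/= => /andP[ay yb].
      have yx : `|y| <= `|x|.
        move: ax bx; rewrite !ler_norml; lra.
      rewrite -(subrr (f y)); apply: is_deriveB.
        by apply: (HG m).2; apply: le_lt_trans xm.
      by apply: (HG n).2; apply: le_lt_trans xn.
    have Dc : {within `[a, b], continuous (G m - G n)}.
      apply: derivable_within_continuous => y /D [//].
    have D' y : y \in `]a, b[%R -> is_derive y 1 (G m - G n) 0.
      by move=> /subset_itv_oo_cc /D.
    have [c _ /eqP] := MVT_segment ab D' Dc.
    by rewrite mul0r subr_eq0 => /eqP.
  have : (G m - G n) x = (G m - G n) 0.
    have [x0|x0] := leP 0 x; first by rewrite (key 0 x) // normr0.
    by rewrite (key x 0) ?normr0 // ltW.
  rewrite !fctE (HG m).1 (HG n).1 subrr => /eqP; rewrite subr_eq0 => /eqP //.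
exists (fun x => G (Num.truncn `|x|) x) => x.
have tr (y : R) : `|y| < (Num.truncn `|y|).+1%:R by exact: truncnS_gt.
pose n := Num.truncn `|x|.
apply: (@near_eq_is_derive _ _ _ (G n)).
  have : \forall y \near x, - n.+1%:R < y < n.+1%:R.
    by apply: near_between; rewrite -ltr_norml; exact: tr.
  by apply: filterS => y; rewrite -ltr_norml => yn; apply: Geq.
exact: ((HG n).2 _ (tr x)).
Qed.

(* A nonnegative Lipschitz function cannot drop quickly, so a variation [d] of
   [w] costs [S] an increase of order [d ^+ 2]. *)
Lemma lipschitz_derivative_sq (R : realType) (w S : R -> R) (L u v : R) : 0 < L ->
  (forall x, 0 <= w x) -> (forall x y, `|w x - w y| <= L * `|x - y|) ->
  (forall x : R, is_derive x 1 S (w x)) ->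
  (w u - w v) ^+ 2 <= 4 * L * `|S u - S v|.
Proof.
move=> L0 w0 wL SD.
have mvt (a b : R) : a <= b -> exists2 c, a <= c <= b & S b - S a = w c * (b - a).
  move=> ab; have [c] := MVT_segment ab (fun x _ => SD x)
    (continuous_subspaceT (is_derive_continuous R S w SD)).
  by rewrite in_itv /=; exists c.
have Smono (a b : R) : a <= b -> S a <= S b.
  by move=> ab; have [c _ E] := mvt _ _ ab; rewrite -subr_ge0 E mulr_ge0 // subr_ge0.
wlog wuv : u v / w u <= w v.
  move=> H; case: (leP (w u) (w v)) => [/H //|/ltW /H].
  by rewrite -sqrrN opprB distrC.
set d := w v - w u; have d0 : 0 <= d by rewrite subr_ge0.
rewrite -sqrrN opprB -/d.
(* Within distance [h] of [v] the function [w] stays above [d / 2], and an interval of length [h]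
   next to [v] still lies between [u] and [v]. There [S] increases by at least [h * (d / 2)], which
   is [d ^+ 2 / (4 * L)]. *)
pose h := d / (2 * L).
have h0 : 0 <= h by rewrite divr_ge0 // mulr_ge0 // ltW.
have dE : d = 2 * L * h by rewrite /h mulrC divfK // gt_eqF // mulr_gt0.
have dL : d <= L * `|u - v|.
  by apply: le_trans (wL u v); rewrite distrC ler_norm.
have huv : 2 * h <= `|u - v|.
  by rewrite -(ler_pM2l L0); apply: le_trans dL; rewrite dE; lra.
have low c : `|v - c| <= h -> d / 2 <= w c.
  move=> hc; have := wL v c; have : L * `|v - c| <= L * h by rewrite ler_pM2l.
  have := ler_norm (w v - w c); have := w0 u.
  rewrite /d in dE *; lra.
have main : h * (d / 2) <= `|S u - S v|.
  case: (leP u v) => uv.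
    have [c /andP[c1 c2] E] := mvt (v - h) v ltac:(lra).
    have cl : d / 2 <= w c by apply: low; rewrite ler_norml; lra.
    have : S u <= S (v - h).
      by apply: Smono; move: huv; rewrite distrC ger0_norm ?subr_ge0 //; lra.
    have : h * (d / 2) <= S v - S (v - h).
      rewrite E mulrC; have -> : v - (v - h) = h by ring.
      by rewrite ler_wpM2r.
    have := ler_norm (S v - S u); rewrite distrC; lra.
  have [c /andP[c1 c2] E] := mvt v (v + h) ltac:(lra).
  have cl : d / 2 <= w c by apply: low; rewrite ler_norml; lra.
  have : S (v + h) <= S u.
    by apply: Smono; move: huv; rewrite gtr0_norm ?subr_gt0 //; lra.
  have : h * (d / 2) <= S (v + h) - S v.
    rewrite E mulrC; have -> : v + h - v = h by ring.
    by rewrite ler_wpM2r.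
  have := ler_norm (S u - S v); lra.
have -> : d ^+ 2 = 4 * L * (h * (d / 2)).
  by rewrite [d in X in _ = X]dE [in LHS]dE; field.
by rewrite ler_pM2l // mulr_gt0.
Qed.

(** * A fat Cantor set and its staircase *)

(** Inner regularity of Lebesgue measure on the irrationals of the unit interval replaces an
    explicit Cantor construction. Missing every rational is what gives empty interior. *)
Lemma compact_irrationals (R : realType) : exists D : set R,
  [/\ compact D, D `<=` `[0, 1], (forall q : rat, ~ D (ratr q))
    & (0 < lebesgue_measure D)%E].
Proof.
pose Q : set R := range ratr.
have mQ : measurable (Q : set (measurableTypeR R)).
  apply: countable_measurable; first by move=> t; exact: measurable_set1.
  apply: (sub_countable (card_image_le _ _)).
  by rewrite (eq_countable card_rat); exact: countableP.
pose mu : set R -> \bar R := lebesgue_measure.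
pose E : set R := `[0, 1] `\` Q.
have mE : measurable (E : set (measurableTypeR R)) by exact: measurableD.
have muE : mu E = 1%E.
  rewrite /mu /E measureD //=; last first.
    by rewrite lebesgue_measure_itv /= lte_fin ltr01 -EFinD ltry.
  rewrite lebesgue_measure_itv /= lte_fin ltr01.
  have -> : lebesgue_measure (`[0%R, 1%R] `&` Q) = 0%E.
    apply/eqP; rewrite eq_le measure_ge0 andbT -(lebesgue_measure_rat R).
    by apply: le_measure; rewrite ?inE //; exact: measurableI.
  by rewrite !sube0.
have finE : (mu E < +oo)%E by rewrite muE ltry.
(* The tolerance 1 is the full measure of [E]; as the bound is strict, [D] cannot be null. *)
have [D [cD DE lt1]] := lebesgue_regularity_inner mE finE ltr01.
exists D; split => //.
- by move=> x /DE [].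
- by move=> q /DE [_]; apply; exists q.
- rewrite lt0e measure_ge0 andbT; apply/eqP => D0.
  have mD : measurable (D : set (measurableTypeR R)) by exact: compact_measurable.
  have ED : mu (E `\` D) = (mu E - mu D)%E by rewrite /mu measureD // setIidr.
  have : (mu (E `\` D) < 1%:E)%E by exact: lt1.
  by rewrite ED muE {1}/mu D0 sube0 ltxx.
Qed.

(* [m u] is the Lebesgue measure of the part of [D] to the left of [u]. *)
Lemma fat_staircase (R : realType) : exists (D : set R) (m : R -> R),
  [/\ closed D, D `<=` `[0, 1],
      (forall u v, u < v -> exists2 x, u < x < v & ~ D x)
    & [/\ {homo m : u v / u <= v}, (forall u v, u <= v -> m v - m u <= v - u),
      (forall u v, u <= v -> (forall x, u < x <= v -> ~ D x) -> m u = m v),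
      m (-1) = 0 & 0 < m 1]].
Proof.
have [D [cD D01 Drat muD]] := compact_irrationals R.
have clD : closed D by exact: compact_closed.
have mD : measurable D by exact: compact_measurable.
pose mu : set R -> \bar R := @lebesgue_measure R.
have fin (A : set R) : measurable A -> (mu (D `&` A) < +oo)%E.
  move=> mA; apply: (@le_lt_trans _ _ (mu D)).
    by apply: le_measure; rewrite ?inE //; exact: measurableI.
  exact: compact_finite_measure.
pose m (u : R) : R := fine (mu (D `&` `]-oo, u])).
have mfin u : mu (D `&` `]-oo, u]) \is a fin_num by rewrite ge0_fin_numE // fin.
have mE u : mu (D `&` `]-oo, u]) = (m u)%:E by rewrite fineK.
have mdiff u v : u <= v -> (m v - m u)%:E = mu (D `&` `]u, v]).
  move=> uv; rewrite EFinB -!mE.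
  have -> : D `&` `]-oo, v] = (D `&` `]-oo, u]) `|` (D `&` `]u, v]).
    rewrite -setIUr; congr (_ `&` _); apply/seteqP; split => x /=; rewrite !in_itv /=.
      by move=> ->; rewrite andbT; case: (leP x u); [left|right].
    by case=> [/le_trans ->|/andP[]].
  rewrite /mu measureU //=; [|exact: measurableI..|].
    by rewrite addeAC subee ?add0e.
  apply/seteqP; split => // x [[_ /=]]; rewrite !in_itv /= => xu [_].
  by move=> /andP[]; rewrite ltNge xu.
exists D, m; split => //.
  move=> u v uv; have [q] := rat_in_itvoo uv; rewrite in_itv /= => quv.
  by exists (ratr q).
split.
- move=> u v uv; rewrite -subr_ge0 -lee_fin mdiff //; exact: measure_ge0.
- move=> u v uv; rewrite -lee_fin mdiff //.
  apply: (@le_trans _ _ (mu `]u, v])).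
    by apply: le_measure; rewrite ?inE //; exact: measurableI.
  rewrite /mu lebesgue_measure_itv /= lte_fin; case: ltP => // vu.
  by rewrite lee_fin subr_ge0.
- move=> u v uv H; apply/eqP; rewrite eq_sym -subr_eq0 -eqe mdiff //.
  have -> : D `&` `]u, v] = set0.
    by apply/seteqP; split => // x [/= Dx]; rewrite in_itv /= => /H.
  by rewrite /mu measure0.
- have -> : m (-1) = fine (mu set0) by
    rewrite /m; congr (fine (mu _)); apply/seteqP; split => // x [/D01 /=]; rewrite !in_itv /= => /andP[x0 _] /(le_trans x0); rewrite oppr_ge0 ler10.
  by rewrite /mu measure0.
- rewrite -lte_fin -mE.
  suff -> : D `&` `]-oo, 1] = D by [].
  by apply/setIidPl => x /D01 /=; rewrite !in_itv /= => /andP[].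
Qed.

(** * Gaps of a closed set and flat functions *)

Lemma left_gap (R : realType) (K : set R) : closed K ->
  (forall u, exists k, [/\ K k, u - 1 <= k & k <= u]) ->
  exists A : R -> R, [/\ forall u, 0 <= A u <= 1, forall u, K (u - A u)
    & forall k u, K k -> k <= u -> A u <= u - k].
Proof.
move=> cK hK.
pose L u := K `&` [set k | k <= u].
have ubL u : has_ubound (L u) by exists u => k [].
have L0 u : L u !=set0 by have [k [Kk _ ku]] := hK u; exists k.
have cL u : closed (L u) by apply: closedI => //; exact: closed_le.
have supL u : L u (sup (L u)).
  by have := closure_sup (L0 u) (ubL u); rewrite -(iffLR (closure_id _) (cL u)).
exists (fun u => u - sup (L u)); split.
- move=> u; have [_ /= us] := supL u; rewrite subr_ge0 us /=.
  have [k [Kk uk ku]] := hK u.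
  have : k <= sup (L u) by apply: ub_le_sup.
  lra.
- by move=> u; have [+ _] := supL u; rewrite opprB addrC subrK.
- move=> k u Kk ku; have : k <= sup (L u) by apply: ub_le_sup.
  lra.
Qed.

(* [A u] and [B u] are the distances from [u] to the nearest points of [K] on
   its left and on its right. *)
Record gap_distances (R : realType) (K : set R) (A B : R -> R) : Prop := GapDistances {
  gap_left01 : forall u, 0 <= A u <= 1;
  gap_right01 : forall u, 0 <= B u <= 1;
  gap_left_le : forall k u, K k -> k <= u -> A u <= u - k;
  gap_right_le : forall k u, K k -> u <= k -> B u <= k - u;
  gap_left_in : forall u, K (u - A u);
  gap_right_in : forall u, K (u + B u);
  gap_shift : forall u v, - A u < v - u < B u ->
    A v = A u + (v - u) /\ B v = B u - (v - u) }.

Arguments gap_left01 {R K A B}.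
Arguments gap_right01 {R K A B}.
Arguments gap_left_in {R K A B}.
Arguments gap_right_in {R K A B}.
Arguments gap_left_le {R K A B} _ {k u}.
Arguments gap_right_le {R K A B} _ {k u}.
Arguments gap_shift {R K A B} _ {u v}.

Lemma gap_distances_exist (R : realType) (K : set R) : closed K ->
  (forall u, exists k, [/\ K k, u - 1 <= k & k <= u]) ->
  exists A B : R -> R, gap_distances R K A B.
Proof.
move=> cK hK.
have [A [A01 KA Ale]] := left_gap _ _ cK hK.
(* The right distance is the left distance of the reflected set. *)
have cK' : closed [set x | K (- x)].
  by apply: (@closed_comp _ _ (@GRing.opp R)) => // x _; exact: opp_continuous.
have hK' u : exists k, [/\ [set x | K (- x)] k, u - 1 <= k & k <= u].
  have [k [Kk uk ku]] := hK (1 - u); exists (- k); split => /=; first by rewrite opprK.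
    lra.
  lra.
have [B' [B01 KB' Ble']] := left_gap _ _ cK' hK'.
pose B u := B' (- u).
have KB u : K (u + B u) by have /= := KB' (- u); rewrite opprD !opprK.
have Ble k u : K k -> u <= k -> B u <= k - u.
  by move=> Kk uk; have := Ble' (- k) (- u); rewrite /= opprK [- u + k]addrC; apply => //; rewrite lerN2.
exists A, B; split => //.
- by move=> u; exact: B01.
- move=> u v /andP[vA vB].
  (* No point of [K] lies strictly between [u - A u] and [u + B u], so a point [v] of this gap has
     the same two endpoints as [u]. *)
  have sep k : K k -> k <= u - A u \/ u + B u <= k.
    move=> Kk; case: (leP k u) => ku.
      by left; have := Ale _ _ Kk ku; lra.
    by right; have := Ble _ _ Kk (ltW ku); lra.
  have /andP[Av0 _] := A01 v; have /andP[Bv0 _] : 0 <= B v <= 1 by exact: B01.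
  have h1 : A v <= v - (u - A u) by apply: Ale => //; lra.
  have h2 : B v <= u + B u - v by apply: Ble => //; lra.
  by have [h3|h3] := sep _ (KA v); have [h4|h4] := sep _ (KB v); split; lra.
Qed.

Lemma gap_left_gt0 {R : realType} {K : set R} {A B : R -> R}
  (gapK : gap_distances R K A B) {u : R} : ~ K u -> 0 < A u.
Proof.
move=> nK; have /andP[A0 _] := gap_left01 gapK u; rewrite lt0r A0 andbT.
by apply/eqP => Au; have := gap_left_in gapK u; rewrite Au subr0.
Qed.

Lemma gap_right_gt0 {R : realType} {K : set R} {A B : R -> R}
  (gapK : gap_distances R K A B) {u : R} : ~ K u -> 0 < B u.
Proof.
move=> nK; have /andP[B0 _] := gap_right01 gapK u; rewrite lt0r B0 andbT.
by apply/eqP => Bu; have := gap_right_in gapK u; rewrite Bu addr0.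
Qed.

(** Meant for points of [K], around which no single formula describes the functions to be
    differentiated. *)
Lemma is_derive_quadratic0 (R : realType) (f : R -> R) (x C : R) :
  (forall y, `|f y - f x| <= C * `|y - x| ^+ 2) -> is_derive x 1 f 0.
Proof.
move=> fC.
have H : h^-1 *: ((f \o shift x) (h *: 1) - f x) @[h --> 0^'] --> (0 : R).
  have C0 : 0 <= C.
    have := fC (x + 1); have -> : x + 1 - x = 1 by ring.
    by rewrite normr1 expr1n mulr1; apply: le_trans.
  apply/cvgr0Pnorm_le => e e0.
  near=> h.
  have h0 : h != 0 by near: h; exact: nbhs_dnbhs_neq.
  have hn : `|h| < e / (C + 1).
    near: h; apply: dnbhs0_lt; rewrite divr_gt0 //; lra.
  rewrite /= normrZ normfV ler_pdivrMl ?normr_gt0 //.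
  apply: le_trans (fC _) _.
  have -> : h *: 1 + x - x = h by rewrite addrK scaler1.
  rewrite expr2 mulrA mulrC ler_wpM2l //.
  apply: (@le_trans _ _ ((C + 1) * `|h|)).
    by rewrite ler_wpM2r //; lra.
  by rewrite mulrC -ler_pdivlMr ?ltW //; lra.
split; first by apply/cvg_ex; exists 0; exact: H.
by apply: cvg_lim; [exact: norm_hausdorff|exact: H].
Unshelve. all: by end_near. Qed.

Lemma is_derive_translate (R : realType) (f : R -> R) (x c df : R) :
  is_derive (x + c) 1 f df -> is_derive x 1 (fun y => f (y + c)) df.
Proof.
have E : (fun h : R => h^-1 *: ((f \o shift (x + c)) (h *: 1) - f (x + c)))
  = (fun h : R => h^-1 *: (((fun y => f (y + c)) \o shift x) (h *: 1) - f (x + c))).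
  by apply/funext => h; rewrite /= addrA.
by move=> [fd <-]; split; [rewrite /derivable -E|rewrite /derive -E].
Qed.

Section flat.
Context {R : realType} {K : set R} {A B : R -> R}.
Hypothesis gapK : gap_distances R K A B.

(* A reparametrization of time that may stop on [K] only. *)
Record time_change (tau : R -> R) : Prop := TimeChange {
  time_change_nonexp : forall x y, `|tau x - tau y| <= `|x - y|;
  time_change_shift : forall x, ~ K (tau x) -> \forall y \near x, tau y = tau x + (y - x) }.

Lemma time_change_id : time_change id.
Proof. split => // x _; near=> y; rewrite /=; ring. Unshelve. all: by end_near. Qed.

Lemma time_change_continuous (tau : R -> R) : time_change tau -> continuous tau.
Proof.
move=> [tn _] x; apply/cvgrPdist_lt => e e0.
near=> z; apply: le_lt_trans (tn _ _) _.
by near: z; exact: cvgr_dist_lt.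
Unshelve. all: by end_near. Qed.

Lemma time_change_near_gap (tau : R -> R) (x : R) : time_change tau -> ~ K (tau x) ->
  \forall y \near x, [/\ tau y = tau x + (y - x),
    A (tau y) = A (tau x) + (y - x) & B (tau y) = B (tau x) - (y - x)].
Proof.
move=> tc nK; have A0 := gap_left_gt0 gapK nK.
have B0 := gap_right_gt0 gapK nK.
have xin : x - A (tau x) < x < x + B (tau x) by lra.
near=> y.
have ty : tau y = tau x + (y - x) by near: y; exact: time_change_shift.
have yin : x - A (tau x) < y < x + B (tau x) by near: y; exact: near_between.
have [-> ->] : A (tau y) = A (tau x) + (tau y - tau x) /\ B (tau y) = B (tau x) - (tau y - tau x).
  by apply: (gap_shift gapK); lra.
by rewrite ty addrAC subrr add0r.
Unshelve. all: by end_near. Qed.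

(** To the right of [u] the factor in [A] is small, to the left the factor in [B]; the other factor
    is at most 1. Both exponents are at least 2 because [v] may be on either side. *)
Lemma gap_monomial_quadratic (i j : nat) (u v : R) : K u -> (2 <= i)%N -> (2 <= j)%N ->
  `|A v ^+ i * B v ^+ j| <= `|v - u| ^+ 2.
Proof.
move=> Ku i2 j2.
have /andP[A0 A1] := gap_left01 gapK v.
have /andP[B0 B1] := gap_right01 gapK v.
rewrite ger0_norm ?mulr_ge0 ?exprn_ge0 //.
have sq (c : R) n : 0 <= c <= 1 -> (2 <= n)%N -> c ^+ n <= c ^+ 2.
  by move=> /andP[c0 c1] n2; rewrite ler_wiXn2l.
have le1 (c : R) n : 0 <= c <= 1 -> c ^+ n <= 1.
  by move=> /andP[c0 c1]; exact: exprn_ile1.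
case: (leP u v) => uv.
  apply: (@le_trans _ _ (A v ^+ i)).
    by rewrite ler_piMr ?exprn_ge0 ?le1 ?B0.
  apply: le_trans (sq _ _ _ i2) _; first by rewrite A0.
  rewrite lerXn2r ?nnegrE //; apply: le_trans (ler_norm _).
  exact: (gap_left_le gapK).
apply: (@le_trans _ _ (B v ^+ j)).
  by rewrite ler_piMl ?exprn_ge0 ?le1 ?A0.
apply: le_trans (sq _ _ _ j2) _; first by rewrite B0.
rewrite lerXn2r ?nnegrE //; rewrite distrC; apply: le_trans (ler_norm _).
by apply: (gap_right_le gapK) => //; exact: ltW.
Qed.

(* In a gap [A] and [B] are affine with slopes 1 and -1; at a point of [K] the
   monomial vanishes to second order. *)
Lemma is_derive_gap_monomial (tau : R -> R) (i j : nat) (x : R) : time_change tau ->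
  (2 <= i)%N -> (2 <= j)%N ->
  is_derive x 1 (fun y => A (tau y) ^+ i * B (tau y) ^+ j)
    (i%:R * (A (tau x) ^+ i.-1 * B (tau x) ^+ j)
     - j%:R * (A (tau x) ^+ i * B (tau x) ^+ j.-1)).
Proof.
move=> tc i2 j2; case: (pselect (K (tau x))) => Kx.
  have A0 : A (tau x) = 0.
    have /andP[A0 _] := gap_left01 gapK (tau x).
    have := gap_left_le gapK Kx (lexx _); lra.
  (* As [i] is at least 2, both [i] and [i.-1] are positive, so the announced derivative is 0 on
     [K]. *)
  rewrite A0 !expr0n; case: i i2 => // -[//|i] _ /=.
  rewrite !mul0r !mulr0 subr0.
  apply: (@is_derive_quadratic0 _ _ _ 1) => y.
  rewrite A0 expr0n /= mul0r subr0 mul1r.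
  apply: le_trans (gap_monomial_quadratic _ _ (tau x) _ Kx _ _) _ => //.
  rewrite lerXn2r ?nnegrE //; exact: time_change_nonexp.
set a := A (tau x); set b := B (tau x).
pose g : R -> R := (cst (a - x) + id) ^+ i * (cst (b + x) - id) ^+ j.
apply: (@near_eq_is_derive _ _ _ g).
  near=> y.
  have [_ -> ->] : [/\ tau y = tau x + (y - x), A (tau y) = a + (y - x) & B (tau y) = b - (y - x)].
    by near: y; exact: time_change_near_gap.
  by rewrite /g !fctE; congr (_ ^+ _ * _ ^+ _) => /=; ring.
apply: is_derive_eq; rewrite !fctE /=.
by rewrite !subrK !addrK /GRing.scale /=; ring.
Unshelve. all: by end_near. Qed.

(** The order [s] bounds all exponents from below. Differentiation keeps this class and lowers [s]
    by one, so [s] counts the derivatives still available. Composition with [tau] is built in so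
    that the slopes of all the leaves, and not only [w], belong to it. *)
Inductive flat (tau : R -> R) (s : nat) : (R -> R) -> Prop :=
| flat_zero : flat tau s (fun=> 0)
| flat_add f c i j : flat tau s f -> (s <= i)%N -> (s <= j)%N ->
    flat tau s (fun x => f x + c * (A (tau x) ^+ i * B (tau x) ^+ j)).

Lemma flat_monomial (tau : R -> R) (s i j : nat) : (s <= i)%N -> (s <= j)%N ->
  flat tau s (fun x => A (tau x) ^+ i * B (tau x) ^+ j).
Proof.
move=> si sj; rewrite (_ : (fun x => _) = fun x => 0 + 1 * (A (tau x) ^+ i * B (tau x) ^+ j)).
  by apply: flat_add => //; exact: flat_zero.
by apply/funext => x; rewrite add0r mul1r.
Qed.

Lemma flat_derive (tau f : R -> R) (s : nat) : time_change tau ->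
  (1 <= s)%N -> flat tau s.+1 f ->
  exists df, flat tau s df /\ forall x : R, is_derive x 1 f (df x).
Proof.
move=> tc s1; elim => [|{}f c i j _ [df [fdf fD]] si sj].
  by exists (fun=> 0); split; [exact: flat_zero|move=> x; exact: is_derive_cst].
pose m1 x := A (tau x) ^+ i.-1 * B (tau x) ^+ j.
pose m2 x := A (tau x) ^+ i * B (tau x) ^+ j.-1.
exists (fun x => df x + (c * i%:R) * m1 x + (- (c * j%:R)) * m2 x); split.
  have si' : (s <= i.-1)%N by rewrite -ltnS prednK // (leq_trans _ si).
  have sj' : (s <= j.-1)%N by rewrite -ltnS prednK // (leq_trans _ sj).
  by do 2?apply: flat_add; rewrite ?(ltnW si) ?(ltnW sj).
move=> x; have D1 := is_derive_gap_monomial _ i j x tc (leq_trans _ si) (leq_trans _ sj).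
have D2 : is_derive x 1 (f + c \*: (fun y => A (tau y) ^+ i * B (tau y) ^+ j))
   (df x + c *: (i%:R * m1 x - j%:R * m2 x)).
  apply: is_deriveD => //; apply: is_deriveZ; apply: D1; by rewrite ltnS.
apply: (@is_derive_eq _ _ _ _ _ _ _ _ D2).
by rewrite /GRing.scale /=; ring.
Qed.

Lemma flat_bounded (tau f : R -> R) (s : nat) : flat tau s f ->
  exists2 C : R, 0 <= C & forall x, `|f x| <= C.
Proof.
elim => [|{}f c i j _ [C C0 fC] _ _].
  by exists 0 => // x; rewrite normr0.
exists (C + `|c|); first by rewrite addr_ge0.
move=> x; apply: le_trans (ler_normD _ _) _; apply: lerD => //.
have /andP[A0 A1] := gap_left01 gapK (tau x).
have /andP[B0 B1] := gap_right01 gapK (tau x).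
rewrite normrM ler_piMr // ger0_norm ?mulr_ge0 ?exprn_ge0 //.
by rewrite mulr_ile1 ?exprn_ge0 ?exprn_ile1.
Qed.

Lemma flat_lipschitz (tau f : R -> R) (s : nat) : time_change tau ->
  (2 <= s)%N -> flat tau s f ->
  exists2 C : R, 0 <= C & forall x y, `|f x - f y| <= C * `|x - y|.
Proof.
case: s => [//|s] tc s1 /(flat_derive _ _ _ tc s1)[df [/flat_bounded[C C0 dfC] fD]].
by exists C => // x y; exact: derivative_bound fD dfC.
Qed.

Lemma flat_derive1 (tau f : R -> R) (s : nat) : time_change tau ->
  (1 <= s)%N -> flat tau s.+1 f ->
  (forall x, derivable f x 1) /\ flat tau s (f^`()).
Proof.
move=> tc s1 /(flat_derive _ _ _ tc s1)[df [dff fD]].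
split; first by move=> x; apply: ex_derive; exact: fD.
rewrite (_ : f^`() = df) //; apply/funext => x.
by rewrite derive1E; apply: derive_val; exact: fD.
Qed.

Lemma flat_derive1n (tau f : R -> R) (n s : nat) : time_change tau ->
  (1 <= s)%N -> flat tau (n + s)%N f -> flat tau s (f^`(n)).
Proof.
move=> tc s1; elim: n f => [//|n IH] f.
have ns : (1 <= n + s)%N by rewrite (leq_trans s1) // leq_addl.
by rewrite addSn derive1Sn => /(flat_derive1 _ _ _ tc ns)[_ /IH].
Qed.

(** Off [K] the map [tau] is locally a translation. If [tau x] is in [K], then [w] vanishes there
    and is Lipschitz, so [S] varies at most quadratically; as [tau] does not expand distances, the
    composite does too, and its derivative is 0, which is [w (tau x)]. *)
Lemma is_derive_time_change (tau w S : R -> R) (C x : R) : time_change tau ->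
  (forall u, K u -> w u = 0) ->
  (forall u v, `|w u - w v| <= C * `|u - v|) -> 0 <= C ->
  (forall u : R, is_derive u 1 S (w u)) ->
  is_derive x 1 (fun y => S (tau y)) (w (tau x)).
Proof.
move=> tc wK wC C0 SD; case: (pselect (K (tau x))) => Kx.
  rewrite wK //; apply: (@is_derive_quadratic0 _ _ _ C) => y.
  have sq (a b : R) : a <= b -> (K a \/ K b) -> `|S b - S a| <= C * `|b - a| ^+ 2.
    move=> ab Kab.
    have [c] := MVT_segment ab (fun x _ => SD x)
      (continuous_subspaceT (is_derive_continuous R S w SD)).
    rewrite in_itv /= => /andP[ac cb] ->.
    rewrite normrM expr2 mulrA ler_wpM2r //.
    have wcd d : K d -> `|c - d| <= `|b - a| -> `|w c| <= C * `|b - a|.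
      move=> Kd cd; have := wC c d; rewrite (wK _ Kd) subr0 => /le_trans; apply.
      by rewrite ler_wpM2l.
    rewrite [`|b - a|]ger0_norm ?subr_ge0 // in wcd *.
    by case: Kab => Kd; apply: (wcd _ Kd); rewrite ler_norml; lra.
  apply: (@le_trans _ _ (C * `|tau y - tau x| ^+ 2)).
    case: (leP (tau x) (tau y)) => txy; first by apply: sq => //; left.
    by rewrite distrC [in leRHS]distrC; apply: sq; [exact: ltW|right].
  rewrite ler_wpM2l // lerXn2r ?nnegrE //; exact: time_change_nonexp.
apply: (@near_eq_is_derive _ _ _ (fun y => S (y + (tau x - x)))).
  near=> y.
  have -> : tau y = tau x + (y - x) by near: y; exact: time_change_shift.
  by congr S; ring.
by apply: is_derive_translate; rewrite addrC subrK.
Unshelve. all: by end_near. Qed.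

End flat.

Arguments time_change {R} K tau.
Arguments flat {R} A B tau s f.

(** * Foliations by translates of a graph *)

Lemma pair_continuous (T U V : topologicalType) (f : T -> U) (g : T -> V) :
  continuous f -> continuous g -> continuous (fun x => (f x, g x)).
Proof. by move=> fc gc x; apply: cvg_pair; [exact: fc|exact: gc]. Qed.

Lemma comp_continuous (T U V : topologicalType) (f : T -> U) (g : U -> V) :
  continuous f -> continuous g -> continuous (fun x => g (f x)).
Proof. by move=> fc gc x; apply: continuous_comp; [exact: fc|exact: gc]. Qed.

Lemma sum_continuous (R : realType) (T : topologicalType) (f g : T -> R) :
  continuous f -> continuous g -> continuous (fun x => f x + g x).
Proof. by move=> fc gc x; apply: cvgD; [exact: fc|exact: gc]. Qed.

Section translates.
Context (R : realType) (f Q g : R -> R).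
Hypotheses (fK : cancel f Q) (QK : cancel Q f).
Hypothesis fD : forall x : R, is_derive x 1 f (g x).
Hypotheses (gc : continuous g) (Qc : continuous Q).

Definition translate (c : R) : R -> R := fun x => f (x + c).

Definition translates : set (set (R * R)) := [set graph (translate c) | c in setT].

Let fc : continuous f. Proof. exact: is_derive_continuous fD. Qed.

(** Thus [Q p.2 - p.1] labels the leaf through [p]. The partition property and the transverse
    coordinate of the charts both come from this label. *)
Lemma graph_translateE (c : R) (p : R * R) : graph (translate c) p <-> Q p.2 = p.1 + c.
Proof. by rewrite /graph /translate /=; split => [->|<-]; rewrite ?fK ?QK. Qed.

Lemma graph_translate_eq (c d : R) (p : R * R) :
  graph (translate c) p -> graph (translate d) p -> c = d.
Proof. by move=> /graph_translateE E /graph_translateE; rewrite E => /addrI. Qed.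

Lemma is_derive_translate_curve (x0 c s : R) :
  is_derive s 1 (fun s => (x0 + s, f (x0 + s + c)) : R * R) (1, g (x0 + s + c)).
Proof.
apply: is_derive_pair.
  have : is_derive s 1 (fun y : R => y + x0) 1 by apply: is_derive_translate; exact: is_derive_id.
  by rewrite (_ : (fun y => _) = fun y => x0 + y) //; apply/funext => y; rewrite addrC.
rewrite (_ : (fun y => _) = fun y => f (y + (x0 + c))).
  by apply: is_derive_translate; rewrite (_ : x0 + s + c = s + (x0 + c)) //; ring.
by apply/funext => y; congr f; ring.
Qed.

Lemma translate_curve_continuous (x0 c : R) :
  continuous (fun s => (x0 + s, f (x0 + s + c)) : R * R).
Proof.
have h : continuous (fun s : R => x0 + s) by apply: sum_continuous => x; [exact: cvg_cst|exact: cvg_id].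
apply: pair_continuous => //; apply: (@comp_continuous _ _ _ (fun s => x0 + s + c)) => //.
by apply: sum_continuous => // x; exact: cvg_cst.
Qed.

Lemma derive_translate_curve (x0 c : R) :
  (fun s => (x0 + s, f (x0 + s + c)) : R * R)^`() = (fun s => (1, g (x0 + s + c))).
Proof.
apply/funext => s; rewrite derive1E; apply: derive_val; exact: is_derive_translate_curve.
Qed.

Lemma translates_partition : partition translates id setT.
Proof.
split.
- apply/seteqP; split => // p _; exists (graph (translate (Q p.2 - p.1))); first by eexists.
  by apply/graph_translateE; rewrite addrC subrK.
- move=> _ _ [c _ <-] [d _ <-] [p /= [pc pd]].
  by rewrite (graph_translate_eq _ _ _ pc pd).
- by move=> _ [c _ <-]; exists (0, f (0 + c)).
Qed.

Lemma graph_translate_path_connected (c : R) : path_connected (graph (translate c)).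
Proof.
move=> [x y] [x' y']; rewrite /graph /= => -> ->.
exists (fun s => (x + s * (x' - x), f (x + s * (x' - x) + c))); split.
- apply: continuous_subspaceT.
  have mc : continuous (fun s : R => s * (x' - x)) by move=> s; apply: cvgMl; exact: cvg_id.
  exact: (comp_continuous R R (R * R)%type _ _ mc (translate_curve_continuous x c)).
- by rewrite mul0r addr0.
- by rewrite mul1r addrC subrK.
- by move=> _ [s _ <-].
Qed.

(** On the leaf labelled [c], the argument [x + c] of the slope equals [Q y]; hence the slope
    depends on the height alone. *)
Lemma translates_tangent : tangent_to_foliation (fun p => (1, g (Q p.2))) translates.
Proof.
move=> _ [x y] [c _ <-]; rewrite /graph /= => ->.
exists (fun s => (x + s, f (x + s + c))); split.
- by rewrite addr0.
- near=> s; split => //.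
    apply: ex_derive; exact: is_derive_translate_curve.
  rewrite derive_translate_curve.
  have lc : continuous (fun s : R => x + s + c).
    by do 2?apply: sum_continuous => //; move=> u; [exact: cvg_cst|exact: cvg_id|exact: cvg_cst].
  have oc : continuous (fun _ : R => 1 : R) by move=> u; exact: cvg_cst.
  exact: (pair_continuous _ _ _ _ _ oc (comp_continuous _ _ _ _ _ lc gc)).
- by rewrite derive_translate_curve addr0 fK.
Unshelve. all: by end_near. Qed.

(** The chart takes the abscissa and the leaf label as coordinates, both centred at [p0]. It is a
    homeomorphism of the whole plane, restricted to the preimage of the square. Since [Q] is only
    continuous, so is the chart across the leaves. *)
Lemma translates_C1_foliation : C1_foliation translates.
Proof.
split; first exact: translates_partition.
  by move=> _ [c _ <-]; exact: graph_translate_path_connected.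
move=> p0; set x0 := p0.1; set c0 := Q p0.2 - x0.
pose phi (p : R * R) := (p.1 - x0, Q p.2 - p.1 - c0).
pose psi (q : R * R) := (x0 + q.1, f (x0 + q.1 + (c0 + q.2))).
have psiK q : phi (psi q) = q.
  by case: q => s t; rewrite /phi /psi /= fK; congr (_, _); ring.
have phiK p : psi (phi p) = p.
  case: p => s t; rewrite /phi /psi /=; congr (_, _); first by ring.
  by rewrite -[RHS]QK; congr f; ring.
have fstc : continuous (@fst R R) by move=> x; exact: cvg_fst.
have sndc : continuous (@snd R R) by move=> x; exact: cvg_snd.
have phic : continuous phi.
  apply: pair_continuous; apply: sum_continuous => //; try by move=> x; exact: cvg_cst.
  apply: sum_continuous => //; first exact: comp_continuous.
  by move=> x; apply: cvgN; exact: fstc.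
have psic : continuous psi.
  have h : continuous (fun q : R * R => x0 + q.1) by apply: sum_continuous => // x; exact: cvg_cst.
  apply: pair_continuous => //; apply: comp_continuous => //; apply: sum_continuous => //.
  by apply: sum_continuous => // x; exact: cvg_cst.
exists (phi @^-1` @unit_square R), phi, psi; split.
- by rewrite /preimage /unit_square /= /phi /= /c0 /x0 !subrr !in_itv /= ltrN10 ltr01.
- split.
  + apply: open_comp; first by move=> x _; exact: phic.
    by apply: openI; apply: open_comp => [x _|]; [exact: fstc|exact: interval_open|exact: sndc|exact: interval_open].
  + split => //.
    * by move=> _ [p Up <-].
    * by move=> _ [q Vq <-]; rewrite /preimage /= psiK.
    * by split; exact: continuous_subspaceT.
  + move=> _ [c _ <-] p [pc Up].
    have pE : (phi p).2 = c - c0.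
      by move/graph_translateE : pc; rewrite /phi /= => ->; ring.
    (* A leaf meets the domain in a single plaque, so the connected component is the whole
       intersection. *)
    have pl : graph (translate c) `&` phi @^-1` @unit_square R = plaque psi (phi p).2.
      rewrite pE; apply/seteqP; split => [q [qc Uq]|_ [s s1 <-]].
        exists (phi q).1; first by case: Uq.
        rewrite -[RHS]phiK; congr psi.
        rewrite [RHS]surjective_pairing; congr (_, _).
        by move/graph_translateE : qc; rewrite /phi /= => ->; ring.
      split; last by rewrite /preimage /= psiK; split => //=; rewrite -pE; case: Up.
      by rewrite /psi /graph /translate /=; congr f; ring.
    rewrite pl; apply: connected_component_id; first by rewrite -pl.
    apply: connected_continuous_connected.
      by apply/connected_intervalP; exact: interval_is_interval.
    apply: continuous_subspaceT.
    apply: (@comp_continuous _ _ _ (fun s => (s, (phi p).2)) psi) => //.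
    by apply: pair_continuous => x; [exact: cvg_id|exact: cvg_cst].
- have E t : (fun s => psi (s, t)) = fun s => (x0 + s, f (x0 + s + (c0 + t))) by [].
  split.
  + move=> q _; rewrite E; apply: ex_derive; exact: is_derive_translate_curve.
  + move=> q _; rewrite E derive_translate_curve.
    by apply/eqP => -[/eqP]; rewrite oner_eq0.
  + apply: continuous_subspaceT.
    rewrite (_ : (fun q => _) = fun q : R * R => (1, g (x0 + q.1 + (c0 + q.2)))).
      apply: pair_continuous; first by move=> x; exact: cvg_cst.
      apply: comp_continuous => //.
      by do 2?apply: sum_continuous => //; move=> x; exact: cvg_cst.
    by apply/funext => q; rewrite E derive_translate_curve.
Qed.

End translates.

(** * Time changes stopping on the Cantor set *)

Lemma integers_closed (R : realType) : closed [set u : R | exists n : int, u = n%:~R].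
Proof.
rewrite -openC openE => u nu.
have /andP[fu uf] := floor_itv u.
have fu' : (Num.floor u)%:~R < u.
  by rewrite lt_neqAle fu andbT; apply/eqP => E; apply: nu; exists (Num.floor u).
have : \forall z \near u, (Num.floor u)%:~R < z < (Num.floor u + 1)%:~R.
  by apply: near_between; rewrite fu'.
apply: filterS => z zf [n zn]; move: zf; rewrite zn !ltr_int; lia.
Qed.

(** Shrinking an interval to avoid integers before picking a point off [D] shows that adding the
    integers keeps the interior empty. *)
Lemma integers_gap (R : realType) (u v : R) : u < v ->
  exists2 v', u < v' <= v & forall n : int, ~ (u < n%:~R < v').
Proof.
move=> uv; have /andP[fu uf] := floor_itv u.
exists (Num.min v (Num.floor u + 1)%:~R).
  by rewrite lt_min uv uf ge_min lexx.
move=> n /andP[un]; rewrite lt_min => /andP[_].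
rewrite ltr_int => nf; have : (Num.floor u)%:~R < n%:~R :> R by exact: le_lt_trans un.
rewrite ltr_int; lia.
Qed.

(* The integers are added to the fat Cantor set so that its gaps have length at
   most 1, and so that infinitely many of them have length exactly 1, which makes
   the primitive of the weight surjective. *)
Lemma integer_fat_staircase (R : realType) : exists (K : set R) (m : R -> R),
  [/\ closed K, forall n : int, K n%:~R,
      (forall u v, u < v -> exists2 x, u < x < v & ~ K x),
      (forall (n : int) x, n != 0 -> n%:~R < x < (n + 1)%:~R -> ~ K x)
    & [/\ {homo m : u v / u <= v}, (forall u v, u <= v -> m v - m u <= v - u),
      (forall u v, u <= v -> (forall x, u < x <= v -> ~ K x) -> m u = m v),
      m (-1) = 0 & 0 < m 1]].
Proof.
have [D [m [cD D01 hD [m1 m2 m3 m4 m5]]]] := fat_staircase R.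
exists (D `|` [set u : R | exists n : int, u = n%:~R]), m; split => //.
- by apply: closedU => //; exact: integers_closed.
- by move=> n; right; exists n.
- move=> u v uv; have [v' /andP[uv' v'v] hn] := integers_gap _ _ _ uv.
  have [x /andP[ux xv] nDx] := hD _ _ uv'.
  exists x; first by rewrite ux (lt_le_trans xv).
  by case=> // -[n xn]; apply: (hn n); rewrite -xn ux.
- move=> n x n0 /andP[nx xn] [/D01 /=|[k xk]].
    rewrite in_itv /= => /andP[x0 x1].
    have : (0 : int)%:~R < (n + 1)%:~R :> R by exact: le_lt_trans xn.
    have : n%:~R < (1 : int)%:~R :> R by exact: lt_le_trans x1.
    rewrite !ltr_int; lia.
  move: nx xn; rewrite xk !ltr_int; lia.
- split => // u v uv H; apply: m3 => // x ux Dx; apply: (H x) => //; by left.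
Qed.

Lemma continuous_surjective (R : realType) (f : R -> R) : continuous f ->
  (forall y, exists a, f a <= y) -> (forall y, exists b, y <= f b) ->
  forall y, exists x, f x = y.
Proof.
move=> fc lo hi y; have [a fa] := lo y; have [b fb] := hi y.
have hy : Num.min (f a) (f b) <= y <= Num.max (f a) (f b).
  by rewrite ge_min fa le_max fb orbT.
case/orP : (le_total a b) => ab.
  by have [c _ fcy] := IVT ab (continuous_subspaceT fc) hy; exists c.
rewrite minC maxC in hy.
by have [c _ fcy] := IVT ab (continuous_subspaceT fc) hy; exists c.
Qed.

(** Adding the monotone term [t * m u] makes the map expand distances, so its inverse is
    1-Lipschitz. On a gap [m] is constant, so the map and its inverse are translations there. *)
Lemma staircase_time_change {R : realType} {K : set R} {A B m : R -> R} {t : R} :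
  gap_distances R K A B -> 0 <= t ->
  {homo m : u v / u <= v} -> (forall u v, u <= v -> m v - m u <= v - u) ->
  (forall u v, u <= v -> (forall x, u < x <= v -> ~ K x) -> m u = m v) ->
  m (-1) = 0 ->
  continuous (fun u => u + t * m u) /\
  exists tau, [/\ time_change K tau, cancel tau (fun u => u + t * m u)
    & cancel (fun u => u + t * m u) tau].
Proof.
move=> gapK t0 m1 m2 m3 m4; pose theta u := u + t * m u; rewrite -/theta.
have mlip u v : `|m u - m v| <= `|u - v|.
  wlog uv : u v / u <= v.
    move=> H; case: (leP u v) => [/H //|/ltW /H].
    by rewrite distrC [X in _ <= X]distrC.
  by rewrite distrC [X in _ <= X]distrC !ger0_norm ?subr_ge0 ?m2 ?m1.
have mc : continuous m.
  move=> x; apply/cvgrPdist_lt => e e0; near=> z.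
  apply: le_lt_trans (mlip _ _) _.
  by near: z; exact: cvgr_dist_lt.
have thetac : continuous theta.
  by move=> x; apply: cvgD; [exact: cvg_id|apply: cvgMr; exact: mc].
have texp u v : u <= v -> v - u <= theta v - theta u.
  move=> uv; have : 0 <= t * (m v - m u) by rewrite mulr_ge0 // subr_ge0 m1.
  rewrite /theta; lra.
have thetasurj : forall y, exists x, theta x = y.
  apply: continuous_surjective => // y.
    (* By monotonicity [m] is nonpositive to the left of -1 and nonnegative to the right, so there
       [theta] lies below, respectively above, the identity. *)
    exists (Num.min y (-1)); rewrite /theta.
    have : t * m (Num.min y (-1)) <= 0.
      by rewrite mulr_ge0_le0 // -m4; apply: m1; rewrite ge_min lexx orbT.
    have : Num.min y (-1) <= y by rewrite ge_min lexx.
    lra.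
  exists (Num.max y (-1)); rewrite /theta.
  have : 0 <= t * m (Num.max y (-1)).
    by rewrite mulr_ge0 // -m4; apply: m1; rewrite le_max lexx orbT.
  have : y <= Num.max y (-1) by rewrite le_max lexx.
  lra.
split => //; have [tau thetaK] := choice thetasurj.
have expand u v : `|u - v| <= `|theta u - theta v|.
  wlog uv : u v / u <= v.
    move=> H; case: (leP u v) => [/H //|/ltW /H].
    by rewrite distrC [X in _ <= X]distrC.
  rewrite distrC [X in _ <= X]distrC ger0_norm ?subr_ge0 //.
  by apply: le_trans (ler_norm _); exact: texp.
have tauK : cancel theta tau.
  move=> u; apply/eqP; rewrite -subr_eq0 -normr_le0.
  by apply: le_trans (expand _ _) _; rewrite thetaK subrr normr0.
exists tau; split => //; split.
  by move=> x y; rewrite -{2}[x]thetaK -{2}[y]thetaK.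
move=> x nK; set a := tau x.
have A0 := gap_left_gt0 gapK nK.
have B0 := gap_right_gt0 gapK nK.
have : \forall y \near x, x - A a < y < x + B a by apply: near_between; lra.
apply: filterS => y yx.
have ma : m (a + (y - x)) = m a.
  case: (leP y x) => yx'.
    apply: m3; first by lra.
    move=> z /andP[z1 z2] Kz.
    have := gap_left_le gapK Kz z2; lra.
  apply/esym; apply: m3; first by lra.
  move=> z /andP[z1 z2] Kz.
  have := gap_right_le gapK Kz (ltW z1); rewrite -/a; lra.
rewrite -(tauK (a + (y - x))); congr tau.
have : theta a = x by exact: thetaK.
rewrite /theta ma; lra.
Unshelve. all: by end_near. Qed.

(** * The weight and its primitive *)

Lemma unbounded_increments (R : realType) (f : nat -> R) (d : R) : 0 < d ->
  (forall n, f n + d <= f n.+1) -> forall y, exists n, y <= f n.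
Proof.
move=> d0 fd y.
have lin n : f 0%N + d *+ n <= f n.
  elim: n => [|n IH]; first by rewrite addr0.
  by apply: le_trans (fd n); rewrite mulrSr addrA lerD2r.
have [n] : exists n : nat, (y - f 0%N) / d < n%:R.
  by eexists; exact: truncnS_gt.
rewrite ltr_pdivrMr // => /ltW yn; exists n; apply: le_trans (lin n).
by rewrite addrC -lerBlDr -mulr_natl.
Qed.

Definition gap_weight (R : realType) (A B : R -> R) (N : nat) : R -> R :=
  fun u => A u ^+ N * B u ^+ N.

Section weight.
Context {R : realType} {K : set R} {A B : R -> R} {N : nat}.
Hypotheses (gapK : gap_distances R K A B) (N2 : (2 <= N)%N).
Let w := gap_weight R A B N.

Lemma gap_weight_ge0 (u : R) : 0 <= w u.
Proof.
have /andP[A0 _] := gap_left01 gapK u.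
have /andP[B0 _] := gap_right01 gapK u.
by rewrite mulr_ge0 ?exprn_ge0.
Qed.

Lemma gap_weight_eq0 (u : R) : K u -> w u = 0.
Proof.
move=> Ku; have /andP[A0 _] := gap_left01 gapK u.
have Au : A u = 0.
  by apply/eqP; rewrite eq_le A0 andbT; have := gap_left_le gapK Ku (lexx u); rewrite subrr.
by rewrite /w /gap_weight Au expr0n; case: N N2 => // n _; rewrite mul0r.
Qed.

Lemma gap_weight_gt0 (u : R) : ~ K u -> 0 < w u.
Proof.
move=> nK; rewrite mulr_gt0 ?exprn_gt0 //.
  exact: (gap_left_gt0 gapK).
exact: (gap_right_gt0 gapK).
Qed.

Lemma gap_weight_lipschitz : exists2 L, 0 < L & forall u v, `|w u - w v| <= L * `|u - v|.
Proof.
have [L L0 wL] := flat_lipschitz gapK _ _ _ time_change_id N2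
  (flat_monomial id N N N (leqnn _) (leqnn _)).
exists (L + 1); first by lra.
by move=> u v; apply: le_trans (wL u v) _; rewrite ler_wpM2r //; lra.
Qed.

Hypothesis K_int : forall n : int, K n%:~R.
Hypothesis K_thin : forall u v, u < v -> exists2 x, u < x < v & ~ K x.
Hypothesis K_gap : forall (n : int) x, n != 0 -> n%:~R < x < (n + 1)%:~R -> ~ K x.

(** The midpoint of a gap of length 1 is at distance at least 1/2 from [K] on both sides. The bound
    does not depend on [n], as surjectivity of the primitive requires. *)
Lemma gap_weight_mid (n : int) : n != 0 -> (2^-1 ^+ N) ^+ 2 <= w (n%:~R + 2^-1).
Proof.
move=> n0.
have sep k : K k -> k <= n%:~R \/ n%:~R + 1 <= k.
  move=> Kk; case: (leP k n%:~R) => kn; first by left.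
  right; case: (leP (n%:~R + 1) k) => // kn1.
  by case: (K_gap n k n0 _ Kk); rewrite kn rmorphD.
rewrite expr2 /w /gap_weight; set u := n%:~R + 2^-1.
have hA : 2^-1 <= A u.
  have /andP[A0 _] := gap_left01 gapK u.
  by have [h|h] := sep _ (gap_left_in gapK u); rewrite /u in A0 h *; lra.
have hB : 2^-1 <= B u.
  have /andP[B0 _] := gap_right01 gapK u.
  by have [h|h] := sep _ (gap_right_in gapK u); rewrite /u in B0 h *; lra.
by apply: ler_pM; rewrite ?exprn_ge0 // lerXn2r ?nnegrE //; lra.
Qed.

Section primitive.
Context (S : R -> R).
Hypothesis SD : forall u : R, is_derive u 1 S (w u).

Let mvt (a b : R) : a <= b -> exists2 c, a <= c <= b & S b - S a = w c * (b - a).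
Proof.
move=> ab; have [c] := MVT_segment ab (fun x _ => SD x)
  (continuous_subspaceT (is_derive_continuous R S w SD)).
by rewrite in_itv /=; exists c.
Qed.

Let Smono (a b : R) : a <= b -> S a <= S b.
Proof.
move=> ab; have [c _ E] := mvt _ _ ab.
by rewrite -subr_ge0 E mulr_ge0 ?subr_ge0 ?gap_weight_ge0.
Qed.

(** If [S u = S v], then [S] is constant between them and [w] has a zero there. By
    [lipschitz_derivative_sq] the weight then vanishes on the whole segment, which contains a point
    off [K]. *)
Lemma gap_primitive_increasing : {homo S : u v / u < v}.
Proof.
move=> u v uv; rewrite lt_neqAle Smono ?(ltW uv) // andbT; apply/eqP => Suv.
have [L L0 wL] := gap_weight_lipschitz.
have [x /andP[ux xv] nKx] := K_thin _ _ uv.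
have cst c : u <= c <= v -> S c = S u.
  move=> /andP[uc cv]; apply/eqP; rewrite eq_le [S u <= _]Smono // andbT Suv; exact: Smono.
have [c cuv] := mvt _ _ (ltW uv).
rewrite Suv subrr => /esym/eqP; rewrite mulf_eq0 subr_eq0 [v == u]gt_eqF // orbF => /eqP wc.
have := lipschitz_derivative_sq R w S L x c L0 gap_weight_ge0 wL SD.
rewrite wc subr0 (cst c) // (cst x) ?(ltW ux) ?(ltW xv) // subrr normr0 mulr0.
rewrite leNgt exprn_gt0 //; exact: gap_weight_gt0.
Qed.

Lemma gap_primitive_surjective (y : R) : exists u, S u = y.
Proof.
have [L L0 wL] := gap_weight_lipschitz.
(* From the integer [n] to the next midpoint, [w] climbs from 0 to at least the square of
   [2^-1 ^+ N]; [lipschitz_derivative_sq] turns this into an increase of [S] by [d]. *)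
pose d := ((2^-1 : R) ^+ N) ^+ 4 / (4 * L).
have e0 : 0 < (2^-1 : R) ^+ N by rewrite exprn_gt0 // invr_gt0.
have d0 : 0 < d by rewrite divr_gt0 ?exprn_gt0 // mulr_gt0.
have step (n : int) : n != 0 -> S n%:~R + d <= S (n + 1)%:~R.
  move=> n0; set a : R := n%:~R.
  have := lipschitz_derivative_sq R w S L (a + 2^-1) a L0 gap_weight_ge0 wL SD.
  rewrite (gap_weight_eq0 a) ?subr0; last exact: K_int.
  have Sa : S a <= S (a + 2^-1) by apply: Smono; lra.
  rewrite ger0_norm ?subr_ge0 // => h.
  have : (((2^-1 : R) ^+ N) ^+ 2) ^+ 2 <= w (a + 2^-1) ^+ 2.
    by rewrite lerXn2r ?nnegrE ?gap_weight_ge0 ?exprn_ge0 ?(ltW e0) // gap_weight_mid.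
  move=> /le_trans /(_ h); rewrite -exprM mulrC -ler_pdivrMr ?mulr_gt0 // -/d => dS.
  have : S (a + 2^-1) <= S (n + 1)%:~R by apply: Smono; rewrite rmorphD /= -/a; lra.
  lra.
apply: (continuous_surjective R S (is_derive_continuous R S w SD)) => {}y.
  (* The shifts by one keep the walk in either direction off the interval from 0 to 1, which
     contains [D]. *)
  have [n yn] : exists n : nat, - y <= - S (- (n%:Z) - 1)%:~R.
    apply: (unbounded_increments R (fun n => - S (- (n%:Z) - 1)%:~R) d) => // n.
    have := step (- (n.+1%:Z) - 1) ltac:(lia).
    have -> : - (n.+1%:Z) - 1 + 1 = - n%:Z - 1 by lia.
    lra.
  by exists (- (n%:Z) - 1)%:~R; rewrite -lerN2.
have [n yn] : exists n : nat, y <= S (n%:Z + 1)%:~R.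
  apply: (unbounded_increments R (fun n => S (n%:Z + 1)%:~R) d) => // n.
  have := step (n%:Z + 1) ltac:(lia).
  by have -> : n%:Z + 1 + 1 = n.+1%:Z + 1 by lia.
by exists (n%:Z + 1)%:~R.
Qed.

End primitive.

End weight.

(** At distances up to 1 the Lipschitz bound suffices, since there [d] is at most its power of
    exponent [a]; beyond 1 the bound [C + C] takes over. *)
Lemma lipschitz_bounded_holder (R : realType) (f : R -> R) (C L a : R) (M : set R) :
  0 <= C -> 0 <= L -> (forall x, `|f x| <= C) ->
  (forall x y, `|f x - f y| <= L * `|x - y|) -> 0 < a -> a <= 1 -> holder_on a M f.
Proof.
move=> C0 L0 fC fL a0 a1; exists (L + (C + C)) => x y _ _.
set d := `|x - y|; have d0 : 0 <= d by exact: normr_ge0.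
have [dp|] := ltP 0 d; last first.
  move=> dle; have dE : d = 0 by apply/eqP; rewrite eq_le dle.
  by have := fL x y; rewrite -/d dE mulr0 powR0 ?mulr0 // gt_eqF.
have [d1|d1] := leP d 1.
  apply: le_trans (fL x y) _; rewrite -/d.
  have h : d <= d `^ a by rewrite -[leLHS]powRr1 // ger_powR // dp.
  apply: (@le_trans _ _ (L * d `^ a)); first by rewrite ler_wpM2l.
  by rewrite ler_wpM2r ?powR_ge0 //; lra.
have h : 1 <= d `^ a.
  have <- : 1 `^ a = 1 :> R by rewrite powR1.
  by apply: ge0_ler_powR; rewrite ?nnegrE // ltW.
apply: (@le_trans _ _ (C + C)); first by apply: le_trans (ler_normB _ _) _; apply: lerD.
apply: (@le_trans _ _ (L + (C + C))); first by rewrite lerDr.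
by rewrite ler_peMr //; lra.
Qed.

(** Each differentiation of [df] costs one order of flatness. The derivative of [f] of order
    [Num.truncn r] is therefore still flat of order at least 4, hence bounded and Lipschitz, and so
    Hoelder for the fractional part of [r]. *)
Lemma flat_derivative_class_Cr {R : realType} {K : set R} {A B tau f : R -> R} (df : R -> R)
    {r : R} {N : nat} :
  gap_distances R K A B -> time_change K tau -> 1 <= r ->
  flat A B tau N df -> (Num.truncn r + 3 <= N)%N ->
  (forall x : R, is_derive x 1 f (df x)) -> class_Cr r f.
Proof.
move=> gapK tc r1 dff rN fD.
have fE : f^`() = df by apply/funext => x; rewrite derive1E; apply: derive_val; exact: fD.
have fl n : (n.+1 <= N)%N -> flat A B tau (N - n) (f^`(n.+1)).
  move=> nN; rewrite derive1Sn fE.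
  apply: (flat_derive1n gapK) => //; first by rewrite subn_gt0.
  by rewrite subnKC // ltnW.
have fld n : (n.+2 <= N)%N -> exists df,
    flat A B tau (N - n).-1 df /\ forall x : R, is_derive x 1 (f^`(n.+1)) (df x).
  move=> nN; apply: (flat_derive gapK _ _ _ tc); first by lia.
  by rewrite prednK ?subn_gt0; [exact: fl (ltnW nN)|exact: ltnW].
have r0 : 0 <= r by lra.
have /andP[kr rk] := truncn_itv r0.
have : (0 < Num.truncn r)%N by rewrite truncn_gt0.
rewrite /class_Cr; move: kr rk rN; case: (Num.truncn r) => // k kr rk rN _.
have kN : (k.+2 <= N)%N by lia.
split.
  split=> [[_ x|j jk x]|].
  - by apply: ex_derive; exact: fD.
  - have [g [_ gD]] : exists df, flat A B tau (N - j).-1 df /\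
        forall x : R, is_derive x 1 (f^`(j.+1)) (df x) by apply: fld; lia.
    by apply: ex_derive; exact: gD.
  - by have [g [_ gD]] := fld k kN; exact: is_derive_continuous gD.
move=> a0 M.
have [C C0 fC] := flat_bounded gapK _ _ _ (fl k (ltnW kN)).
have [L L0 fL] : exists2 L, 0 <= L & forall x y, `|derive1n k.+1 f x - derive1n k.+1 f y| <= L * `|x - y|.
  by apply: (flat_lipschitz gapK _ _ _ tc _ (fl k (ltnW kN))); lia.
apply: lipschitz_bounded_holder C0 L0 fC fL a0 _.
by move: rk; rewrite -[k.+2]addn1 natrD; lra.
Qed.

Lemma translate_time_change (R : realType) (K : set R) (tau : R -> R) (c : R) :
  time_change K tau -> time_change K (fun x => tau (x + c)).
Proof.
move=> [tn ts]; split.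
  move=> x y; apply: le_trans (tn _ _) _.
  by rewrite opprD addrACA subrr addr0.
move=> x nK.
have sc : (fun y : R => y + c) @ x --> x + c by apply: cvgD; [exact: cvg_id|exact: cvg_cst].
have H : \forall y \near x, tau (y + c) = tau (x + c) + (y + c - (x + c)) by exact: (sc _ (ts _ nK)).
near=> y; have -> : tau (y + c) = tau (x + c) + (y + c - (x + c)) by near: y.
by congr (_ + _); ring.
Unshelve. all: by end_near. Qed.

(** * The family of foliations *)

(** A common leaf crosses height [y] at abscissa [Q y] by its label 0 in the first family, and at
    [Q' y - c] by its label [c] in the second. *)
Lemma translates_inj (R : realType) (f Q f' Q' : R -> R) : cancel f Q -> cancel Q f ->
  cancel f' Q' -> cancel Q' f' ->
  translates R f = translates R f' -> exists c, forall y, Q' y = Q y + c.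
Proof.
move=> fK QK fK' QK' E.
have : translates R f' (graph (translate R f 0)) by rewrite -E; exists 0.
move=> [c _ cE]; exists c => y.
have : graph (translate R f 0) (Q y, y) by apply/(graph_translateE R f Q fK QK); rewrite addr0.
by rewrite -cE => /(graph_translateE R f' Q' fK' QK').
Qed.

Theorem theorem1p1 (R : realType) (r : R) (hr : 1 <= r) :
  exists X : R * R -> R * R,
    [/\ forall p, X p != 0,
        holder_continuous X
      & exists F : R -> set (set (R * R)),
          [/\ forall t : R, `[0, 1] t -> C1_foliation (F t),
              forall s t : R, `[0, 1] s -> `[0, 1] t -> s <> t -> F s <> F t,
              forall t : R, `[0, 1] t -> tangent_to_foliation X (F t)
            & forall t : R, `[0, 1] t -> forall L, F t L ->
                exists f : R -> R, class_Cr r f /\ L = graph f]].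
Proof.
have [K [m [cK Kint Kthin Kgap [m1 m2 m3 m4 m5]]]] := integer_fat_staircase R.
have Khit (u : R) : exists k, [/\ K k, u - 1 <= k & k <= u].
  exists (Num.floor u)%:~R; have /andP[fu uf] := floor_itv u; split => //.
  move: uf; rewrite rmorphD /=; lra.
have [A [B gapK]] := gap_distances_exist _ _ cK Khit.
pose N := (Num.truncn r + 3)%N; have N2 : (2 <= N)%N by rewrite /N; lia.
pose w := gap_weight R A B N.
have [L L0 wL] := gap_weight_lipschitz gapK N2.
have w0 := gap_weight_ge0 (N := N) gapK.
have wc : continuous w.
  have [dw [_ dwD]] := flat_derive gapK id w N.-1 time_change_id ltac:(lia)
    (ltac:(rewrite prednK; [exact: flat_monomial|lia])).
  exact: is_derive_continuous dwD.
have [S SD] := continuous_primitive _ _ wc.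
have Sinc := gap_primitive_increasing gapK N2 Kthin _ SD.
have Ssurj := gap_primitive_surjective gapK N2 Kint Kgap _ SD.
have [T TK] := choice Ssurj.
have Sinj : injective S by apply: inc_inj; exact: le_mono.
have ST : cancel S T by move=> u; apply: Sinj; rewrite TK.
have Tc : continuous T.
  apply: increasing_surjective_continuous; last by move=> u; exists (S u).
  move=> x y xy; rewrite -(leW_mono (le_mono Sinc)) !TK //.
have tauE (t : R) : exists tau, `[0, 1] t ->
    continuous (fun u => u + t * m u) /\ [/\ time_change K tau,
      cancel tau (fun u => u + t * m u) & cancel (fun u => u + t * m u) tau].
  (* Outside the unit interval [id] is only a default value for the choice function. *)
  case: (pselect (`[0, 1] t)) => [t01|]; last by exists id.
  have t0 : 0 <= t by move: t01; rewrite /= in_itv /= => /andP[].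
  have [thc [tau H]] := staircase_time_change gapK t0 m1 m2 m3 m4.
  by exists tau.
have [tau tauP] := choice tauE.
pose f t x := S (tau t x).
pose Q t y := T y + t * m (T y).
have fK t : `[0, 1] t -> cancel (f t) (Q t).
  by move=> /tauP[_ [_ h _]] x; rewrite /f /Q ST.
have QK t : `[0, 1] t -> cancel (Q t) (f t).
  by move=> /tauP[_ [_ _ h]] y; rewrite /f /Q h TK.
have Qc t : `[0, 1] t -> continuous (Q t).
  by move=> /tauP[h _]; exact: (comp_continuous _ _ _ _ _ Tc h).
have fD t (x : R) : `[0, 1] t -> is_derive x 1 (f t) (w (tau t x)).
  move=> /tauP[_ [tc _ _]].
  have wK := gap_weight_eq0 gapK N2.
  exact: (is_derive_time_change (tau t) w S L x tc wK wL (ltW L0) SD).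
have wtc t : `[0, 1] t -> continuous (fun x => w (tau t x)).
  move=> /tauP[_ [tc _ _]]; apply: comp_continuous => //.
  exact: time_change_continuous tc.
pose X (p : R * R) : R * R := (1, w (T p.2)).
exists X; split.
- by move=> p; apply/eqP => -[/eqP]; rewrite oner_eq0.
- exists 2^-1; split; rewrite ?invr_gt0 // ?invf_le1 ?ler1n //.
  (* Apply [lipschitz_derivative_sq] at [T p.2] and [T q.2], where [S] takes the values [p.2] and
     [q.2]; the square root gives the exponent 1/2. *)
  exists (Num.sqrt (4 * L)) => p q _ _.
  rewrite powR12_sqrt // -sqrtrM; last by rewrite mulr_ge0 // ltW.
  have -> : `|X p - X q| = `|w (T p.2) - w (T q.2)|.
    by rewrite prod_normE /= subrr normr0; apply/max_idPr.
  rewrite -sqrtr_sqr ler_sqrt; last by rewrite mulr_ge0 // mulr_ge0 // ltW.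
  apply: le_trans (lipschitz_derivative_sq R w S L _ _ L0 w0 wL SD) _.
  rewrite !TK ler_pM2l ?mulr_gt0 //.
  by rewrite prod_normE le_max lexx orbT.
exists (fun t => translates R (f t)); split.
- move=> t t01; apply: (translates_C1_foliation R (f t) (Q t) _ (fK t t01) (QK t t01) _ (wtc t t01) (Qc t t01)).
  by move=> x; exact: fD.
- move=> s t s01 t01 st /(translates_inj R _ _ _ _ (fK s s01) (QK s s01) (fK t t01) (QK t t01))[c cE].
  (* Equal foliations would have labels differing by a constant [c]. At height [S (-1)] no delay has
     accumulated, so [c = 0]; at height [S 1] the delays are [s * m 1] and [t * m 1]. *)
  have := cE (S (-1)); rewrite /Q ST m4 !mulr0 !addr0 => /eqP.
  rewrite -subr_eq0 opprD addNKr oppr_eq0 => /eqP c0.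
  have := cE (S 1); rewrite /Q ST c0 addr0 => /addrI.
  have m10 : m 1 != 0 by rewrite gt_eqF.
  by move=> /(mulIf m10) /esym.
- move=> t t01.
  (* The delay cancels in [tau t (Q t y) = T y], which is why one field serves all [t]. *)
  have -> : X = fun p => (1, w (tau t (Q t p.2))).
    by apply/funext => p; have [_ [_ _ h]] := tauP t t01; rewrite /X /Q h.
  apply: (translates_tangent R (f t) (Q t) (fun x => w (tau t x)) (fK t t01)).
    by move=> x; exact: fD.
  exact: wtc.
- move=> t t01 _ [c _ <-]; exists (translate R (f t) c); split => //.
  have [_ [tc _ _]] := tauP t t01.
  apply: (flat_derivative_class_Cr (fun x => w (tau t (x + c))) gapK
    (translate_time_change _ _ _ c tc) hr (N := N)).
  + exact: flat_monomial.
  + exact: leqnn.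
  + by move=> x; exact: (is_derive_translate R (f t) x c _ (fD t (x + c) t01)).
Qed.
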